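(* Let $F:[0,1]^n\to\mathbb R$ be a monotone, non-negative, one-sided $\sigma$-smooth function and $P\subseteq[0,1]^n$ a polytime separable downward-closed polytope, and let $\alpha\in[0,1)$. Assume $F$ satisfies a $\mu$ bound for some $\mu=\mu(\alpha,\sigma)\in(0,1]$ and in addition that there is $\beta\in(0,1]$ with \[ u^T\nabla F(x+\epsilon u)\ge\beta\,u^T\nabla F(x) \] for all $u,x\in P$ and $\epsilon\in[0,1]$ such that $x+\epsilon u\in P$. Then the one-step discrete greedy point $x^1=\alpha v^*+(1-\alpha)v_{max}(\alpha v^* )$ satisfies \[ F(x^1)\ge\big(1-\exp(-\beta(1-\alpha)\mu)\big)\,OPT, \] where $OPT=\max_{x\in P}F(x)$.
   Context: $F$ is $C^2$; monotone means nondecreasing in each coordinate. One-sided $\sigma$-smooth: $\frac12u^T\nabla^2F(x)u\le\sigma\frac{\|u\|_1}{\|x\|_1}u^T\nabla F(x)$ for all $u,x\ge0$, $x\ne0$. $v^*\in\arg\max_{x\in P}\|x\|_1$, $v_{max}(x)\in\arg\max_{v\in P}v^T\nabla F(x)$. $\mu$ bound: $v_{max}(x)\cdot\nabla F(x)\ge\mu(OPT-F(x))$ for all $x\in P$ with $x\ge\alpha v^*$. *)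

(* Defs.v *)
From HB Require Import structures.
From mathcomp Require Import all_boot all_order all_algebra.
From mathcomp Require Import all_classical all_reals all_analysis.

Set Implicit Arguments.
Unset Strict Implicit.
Unset Printing Implicit Defensive.

Import Order.TTheory GRing.Theory Num.Theory.
Import numFieldNormedType.Exports.

Local Open Scope classical_set_scope.
Local Open Scope ring_scope.

Section Vectors.
Context {R : realType} {n : nat}.
Implicit Types (x y u v : 'rV[R]_n) (P : set 'rV[R]_n).

Definition lev x y : Prop := forall i, x 0 i <= y 0 i.

Definition norm1 x : R := \sum_i `|x 0 i|.

Definition dotv u v : R := \sum_i u 0 i * v 0 i.

Definition cube : set 'rV[R]_n := [set x | forall i, 0 <= x 0 i <= 1].

(* Boundedness is not required here: it is used with P included in the cube. *)
Definition polyhedron P : Prop :=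
  exists (m : nat) (A : 'M[R]_(m, n)) (b : 'cV[R]_m),
    P = [set x | forall k, (A *m x^T) k 0 <= b k 0].

Definition polytope_in_cube P : Prop := polyhedron P /\ P `<=` cube.

Definition downward_closed P : Prop :=
  forall x y, P x -> lev 0 y -> lev y x -> P y.

Definition argmax P (f : 'rV[R]_n -> R) : set 'rV[R]_n :=
  [set x | P x /\ forall y, P y -> f y <= f x].

Definition is_max P (f : 'rV[R]_n -> R) (M : R) : Prop :=
  exists2 x, argmax P f x & f x = M.

End Vectors.

(* Functions on the cube are total functions on R^n whose values outside the
   cube are never looked at: the difference quotients below only use points of
   the cube, so that partial derivatives at the boundary are one-sided. *)
Section Derivatives.
Context {R : realType} {n : nat}.
Implicit Types (f F : 'rV[R]_n -> R) (x u : 'rV[R]_n) (i : 'I_n).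

Definition quotients f i x : set_system R :=
  (fun h : R => h^-1 * (f (x + h *: delta_mx 0 i) - f x))
    @ within [set h : R | cube (x + h *: delta_mx 0 i)] 0^'.

Definition has_partial f i x : Prop := cvg (quotients f i x).

(* Only meaningful where [has_partial f i x]. *)
Definition partial f i x : R := lim (quotients f i x).

Definition grad f x : 'rV[R]_n := \row_i partial f i x.

Definition hessian f x : 'M[R]_n :=
  \matrix_(i, j) partial (partial f j) i x.

Definition C1_on_cube f : Prop :=
  {within cube, continuous f} /\
  forall i, (forall x, cube x -> has_partial f i x) /\
            {within cube, continuous (partial f i)}.

Definition C2_on_cube f : Prop :=
  C1_on_cube f /\ forall i, C1_on_cube (partial f i).

Definition monotone_on_cube F : Prop :=
  forall i x (h : R), 0 <= h -> cube x -> cube (x + h *: delta_mx 0 i) ->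
    F x <= F (x + h *: delta_mx 0 i).

Definition one_sided_smooth (sigma : R) F : Prop :=
  forall u x, lev 0 u -> cube x -> x != 0 ->
    2^-1 * (u *m hessian F x *m u^T) 0 0
      <= sigma * (norm1 u / norm1 x) * dotv u (grad F x).

End Derivatives.

(* Main.v *)
Require Import Defs.
From mathcomp Require Import all_boot all_order all_algebra.
From mathcomp Require Import all_classical all_reals all_analysis.
From mathcomp Require Import lra.

Import Order.TTheory GRing.Theory Num.Theory.
Import numFieldNormedType.Exports.

Local Open Scope classical_set_scope.
Local Open Scope ring_scope.

(** Put x0 = alpha v* and v = v_max(x0). The segment x0 + t v, 0 <= t <= 1 - alpha,
    stays in P, and along it the derivative v . grad F(x0 + t v) is at least
    beta v . grad F(x0) >= beta mu (OPT - F x0). With c = beta (1 - alpha) mu <= 1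
    the mean value theorem gives F(x1) >= F x0 + c (OPT - F x0) >= c OPT, and
    c >= 1 - exp(- c). The segment may run inside the boundary of the cube, where
    only one-sided partial derivatives exist, so the chain rule is derived from
    mean value theorems along the coordinate axes and the continuity of the
    partial derivatives on the cube. *)

(** * Partial derivatives and mean values along coordinate axes *)

(** Turns the restricted limit in [quotients] into an ordinary one wherever all small increments are
    admissible. *)
Lemma cvg_within_full (T : Type) (U : topologicalType) (G : set_system T)
    (FG : Filter G) (D : set T) (f : T -> U) (l : U) :
  G D -> f @ within D G --> l -> f @ G --> l.
Proof.
move=> GD fl B /fl; rewrite /within /= !nbhs_filterE /= => GB.
by apply: filterS2 GD GB => t Dt; apply.
Qed.

Section CubeCalculus.
Set Implicit Arguments.
Context {R : realType} {n : nat}.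
Implicit Types (f : 'rV[R]_n -> R) (x y z a d : 'rV[R]_n) (i : 'I_n).

Lemma cvg_line a d (s : R) : (fun t : R => a + t *: d) @ s --> a + s *: d.
Proof. by apply: cvgD; [exact: cvg_cst|apply: cvgZl; exact: cvg_id]. Qed.

Lemma within_continuous_line f a d (l r : R) :
  {within cube, continuous f} ->
  (forall t, t \in `[l, r] -> cube (a + t *: d)) ->
  {within `[l, r], continuous (fun t : R => f (a + t *: d))}.
Proof.
move=> /subspace_continuousP fc ac; apply/subspace_continuousP => s sI B.
move=> /(fc _ (ac _ sI)) /= Bn; have := @cvg_line a d s _ Bn.
rewrite /within /= !nbhs_simpl /=; apply: filterS => t /= + tI.
by apply; exact: ac.
Qed.

Lemma cubeD_delta x i (h : R) : cube x -> 0 <= x 0 i + h <= 1 ->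
  cube (x + h *: delta_mx 0 i).
Proof.
move=> cx ch j; rewrite !mxE eqxx /=.
by have [->|_] := eqVneq j i; rewrite ?mulr1 // mulr0 addr0.
Qed.

(** Only coordinate [i] has to be interior: small moves along axis [i] then stay in the cube, even
    if other coordinates lie on its boundary. *)
Lemma is_derive_partial f i y (s : R) :
  has_partial f i (y + s *: delta_mx 0 i) ->
  cube (y + s *: delta_mx 0 i) -> 0 < y 0 i + s < 1 ->
  is_derive s 1 (fun t : R => f (y + t *: delta_mx 0 i))
    (partial f i (y + s *: delta_mx 0 i)).
Proof.
move=> fp cs sI; set x := y + _.
have D0 : 0^' [set h : R | cube (x + h *: delta_mx 0 i)].
  apply: nbhs_dnbhs; exists (Num.min (y 0 i + s) (1 - (y 0 i + s))) => /=.
    by rewrite lt_min; lra.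
  move=> h /=; rewrite sub0r normrN lt_min => /andP[].
  rewrite !ltr_norml => h1 h2.
  by apply: cubeD_delta => //; rewrite !mxE !eqxx mulr1; lra.
have dq : (fun h : R => h^-1 *: (((fun t : R => f (y + t *: delta_mx 0 i)) \o
    shift s) (h *: (1 : R)) - f x)) @ 0^' --> partial f i x.
  apply: (@cvg_within_full _ _ _ _ _ _ _ D0).
  rewrite [X in X @ _ --> _](_ : _ =
    (fun h : R => h^-1 * (f (x + h *: delta_mx 0 i) - f x))); first exact: fp.
  apply/funext => h /=; rewrite /shift /= /x -[in RHS]addrA -scalerDl.
  by rewrite [h *: 1]mulr1 [h + s]addrC.
by apply: DeriveDef; [apply: cvgP dq|apply: cvg_lim dq].
Qed.

(** The mean value theorem needs derivatives only strictly between the endpoints, where coordinate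
    [i] is interior. The factor [t * h] serves both signs of [h]. *)
Lemma partial_mean_value f i y (h : R) : C1_on_cube f ->
  cube y -> cube (y + h *: delta_mx 0 i) ->
  exists2 t : R, 0 <= t <= 1 &
    f (y + h *: delta_mx 0 i) - f y =
    h * partial f i (y + (t * h) *: delta_mx 0 i).
Proof.
move=> fC1.
(* For negative [h] the endpoints are exchanged, which turns [t] into [1 - t]. *)
wlog h0 : y h / 0 <= h.
  move=> pos cy cz; have [h0|h0] := leP 0 h; first exact: pos.
  set z := y + h *: _ in cz *.
  have yE : y = z + (- h) *: delta_mx 0 i by rewrite scaleNr addrK.
  have [|||t t01 E] := pos z (- h); rewrite ?oppr_ge0 ?(ltW h0) -?yE//.
  exists (1 - t); first lra.
  have -> : y + ((1 - t) * h) *: delta_mx 0 i = z + (t * - h) *: delta_mx 0 i.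
    by rewrite /z -addrA -scalerDl; congr (_ + _ *: _); lra.
  by move: E; rewrite -yE; lra.
move=> cy cz.
have [fc /(_ i)[fp _]] := fC1.
have zi : y 0 i + h <= 1.
  by have /andP[_] := cz i; rewrite !mxE !eqxx mulr1.
have yi : 0 <= y 0 i by have /andP[] := cy i.
have seg t : t \in `[0, h] -> cube (y + t *: delta_mx 0 i).
  by rewrite in_itv /= => tI; apply: cubeD_delta => //; lra.
have [|c] := @MVT_segment R (fun t : R => f (y + t *: delta_mx 0 i))
    (fun t : R => partial f i (y + t *: delta_mx 0 i)) _ _ h0 _
    (@within_continuous_line f y _ 0 h fc seg).
  move=> s sI; have cs : cube (y + s *: delta_mx 0 i).
    by apply: seg; apply: subset_itv_oo_cc sI.
  move: sI; rewrite in_itv /= => sI.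
  by apply: is_derive_partial => //; [exact: fp|lra].
rewrite in_itv /= scale0r addr0 subr0 => cI ->.
have [h00|h00] := eqVneq h 0; first by exists 0; [lra|rewrite h00; lra].
have hp : 0 < h by rewrite lt_neqAle eq_sym h00.
exists (c / h); last by rewrite divfK // mulrC.
by rewrite divr_ge0 ?ler_pdivrMr//; lra.
Qed.

(** * Chain rule along segments of the cube *)

(** The coordinatewise bound makes each [xi i] tend to [y] as [z] does, so that continuity of the
    partial derivatives can be applied. *)
Lemma increment_partial f y z : C1_on_cube f -> cube y -> cube z ->
  exists xi : 'I_n -> 'rV[R]_n,
    (forall i, cube (xi i) /\
      forall j, `|y 0 j - xi i 0 j| <= `|y 0 j - z 0 j|) /\
    f z - f y = \sum_i (z 0 i - y 0 i) * partial f i (xi i).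
Proof.
move=> fC1 cy cz.
(* Telescope along the path from y to z that changes one coordinate at a time. *)
pose w (k : nat) : 'rV[R]_n := \row_j if (j < k)%N then z 0 j else y 0 j.
have cw k : cube (w k) by move=> j; rewrite mxE; case: ifP.
have wS (i : 'I_n) : w i.+1 = w i + (z 0 i - y 0 i) *: delta_mx 0 i.
  apply/rowP => j; rewrite !mxE eqxx /= ltnS leq_eqVlt -[(_ == _ :> nat)]/(j == i).
  have [->|_] /= := eqVneq j i; last by rewrite mulr0 addr0.
  by rewrite ltnn mulr1; lra.
(* A sigma type, so that the intermediate points can be collected into a function of [i]. *)
have step (i : 'I_n) : {x | (cube x /\
      forall j, `|y 0 j - x 0 j| <= `|y 0 j - z 0 j|) &
    f (w i.+1) - f (w i) = (z 0 i - y 0 i) * partial f i x}.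
  apply: cid2; have [||t t01 E] := @partial_mean_value f i (w i) (z 0 i - y 0 i) fC1.
  - exact: cw.
  - by rewrite -wS; exact: cw.
  exists (w i + (t * (z 0 i - y 0 i)) *: delta_mx 0 i); last by rewrite wS.
  split.
    apply: cubeD_delta; first exact: cw.
    rewrite mxE ltnn; have /andP[] := cy i; have /andP[] := cz i.
    move: t01 => /andP[]; set b := z 0 i; set c := y 0 i => *.
    have -> : c + t * (b - c) = (1 - t) * c + t * b by lra.
    apply/andP; split; first by apply: addr_ge0; apply: mulr_ge0; lra.
    have : (1 - t) * c <= (1 - t) * 1 by apply: ler_wpM2l; lra.
    have : t * b <= t * 1 by apply: ler_wpM2l; lra.
    lra.
  move=> j; rewrite !mxE eqxx /=; have [->|_] := eqVneq j i.
    rewrite ltnn mulr1 opprD addrA subrr sub0r normrN normrM distrC.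
    by rewrite ler_piMl // ger0_norm; lra.
  by rewrite mulr0 addr0; case: ifP => _ //; rewrite subrr normr0.
exists (fun i => s2val (step i)); split=> [i|]; first exact: (s2valP (step i)).
have wn : w n = z by apply/rowP => j; rewrite mxE ltn_ord.
have w0 : w 0%N = y by apply/rowP => j; rewrite mxE.
rewrite -[in LHS]wn -[in LHS]w0 -(telescope_sumr (f \o w)) // big_mkord /=.
by apply: eq_bigr => i _; exact: (s2valP' (step i)).
Qed.

(** The difference quotient is a combination of partial derivatives at nearby points of the cube,
    with the coordinates of [d] as weights; continuity moves these points to [x]. *)
Lemma is_derive_line f a d (l r s : R) : C1_on_cube f ->
  (forall t, t \in `[l, r] -> cube (a + t *: d)) -> s \in `]l, r[ ->
  is_derive s 1 (fun t : R => f (a + t *: d)) (dotv d (grad f (a + s *: d))).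
Proof.
move=> fC1 seg sI; set x := a + s *: d.
have cx : cube x by apply: seg; apply: subset_itv_oo_cc sI.
have dq : (fun h : R => h^-1 *: (((fun t : R => f (a + t *: d)) \o
    shift s) (h *: (1 : R)) - f x)) @ 0^' --> dotv d (grad f x).
  apply/cvgrPdist_le => e e0.
  (* The summand 1 keeps [M] positive when [d = 0]. An error [e / M] in each partial derivative adds
     up to at most [e]. *)
  pose M := \sum_i `|d 0 i| + 1.
  have M0 : 0 < M by rewrite ltr_wpDl // sumr_ge0.
  have dM i : `|d 0 i| < M.
    by rewrite /M (bigD1 i) //= -addrA ltr_pwDr// ltr_wpDl// sumr_ge0.
  have : \forall y \near within cube (nbhs x),
      forall i, `|partial f i x - partial f i y| <= e / M.
    apply: filter_forall => i; have [_ /(_ i)[_ /subspace_continuousP]] := fC1.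
    by move=> /(_ _ cx) /cvgrPdist_le; apply; rewrite divr_gt0.
  rewrite /within /= => /nbhs_ballP[del /= del0 ball_del].
  have near_h : \forall h \near (0 : R)^', `|h| < del / M.
    by apply: dnbhs0_lt; rewrite divr_gt0.
  have near_I : \forall h \near (0 : R)^', s + h \in `[l, r].
    apply: nbhs_dnbhs; exists (Num.min (s - l) (r - s)) => /=.
      by move: sI; rewrite in_itv /= lt_min; lra.
    move=> h /=; rewrite sub0r normrN lt_min => /andP[].
    by rewrite !ltr_norml in_itv /= => h1 h2; lra.
  have near_0 : \forall h \near (0 : R)^', h != 0 by exact: nbhs_dnbhs_neq.
  near=> h.
  have h0 : h != 0 by near: h.
  have cz : cube (a + (s + h) *: d) by apply: seg; near: h.
  have hd : `|h| < del / M by near: h.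
  have zE : a + (s + h) *: d = x + h *: d by rewrite scalerDl addrA.
  have [xi [xiP xiE]] := increment_partial fC1 cx cz.
  rewrite /= /shift /= [h *: 1]mulr1 [h + s]addrC xiE.
  have -> : h^-1 *: (\sum_i ((a + (s + h) *: d) 0 i - x 0 i) *
      partial f i (xi i)) = \sum_i d 0 i * partial f i (xi i).
    rewrite scaler_sumr; apply: eq_bigr => i _.
    by rewrite zE !mxE addrAC subrr add0r -mulrA [LHS]mulKf.
  rewrite /dotv -sumrB (le_trans (ler_norm_sum _ _ _)) //.
  apply: (@le_trans _ _ (\sum_i `|d 0 i| * (e / M))).
    apply: ler_sum => i _; rewrite mxE -mulrBr normrM ler_wpM2l //.
    have [cxi xi_near] := xiP i; apply: ball_del => //; split=> // k j.
    rewrite ord1 /ball /= (le_lt_trans (xi_near j)) // zE !mxE.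
    rewrite opprD addrA subrr sub0r normrN normrM.
    apply: (@le_lt_trans _ _ (`|h| * M)); first by rewrite ler_wpM2l// ltW.
    by rewrite -ltr_pdivlMr.
  rewrite -mulr_suml mulrA ler_pdivrMr // mulrC ler_wpM2l ?(ltW e0) //.
  by rewrite /M lerDl.
by apply: DeriveDef; [apply: cvgP dq|apply: cvg_lim dq].
Unshelve. all: by end_near. Qed.

Lemma line_increment_ge f a d (r m : R) : C1_on_cube f -> 0 <= r ->
  (forall t, 0 <= t <= r -> cube (a + t *: d)) ->
  (forall t, 0 <= t <= r -> m <= dotv d (grad f (a + t *: d))) ->
  r * m <= f (a + r *: d) - f a.
Proof.
move=> fC1 r0 seg ge_m.
have seg' t : t \in `[0, r] -> cube (a + t *: d) by rewrite in_itv; exact: seg.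
have [|c] := @MVT_segment R (fun t : R => f (a + t *: d))
    (fun t : R => dotv d (grad f (a + t *: d))) _ _ r0 _
    (@within_continuous_line f a d 0 r (proj1 fC1) seg').
  by move=> s; exact: is_derive_line.
rewrite in_itv /= scale0r addr0 subr0 => cI ->.
by rewrite mulrC ler_wpM2r // ge_m.
Qed.

(** * Convexity of the polytope and the greedy step *)

Lemma polyhedron_convex (P : set 'rV[R]_n) x y (t : R) : polyhedron P ->
  0 <= t <= 1 -> P x -> P y -> P (t *: x + (1 - t) *: y).
Proof.
move=> [m [A [b ->]]] /andP[t0 t1] /= Px Py k.
rewrite linearD !linearZ /= mulmxDr -!scalemxAr !mxE.
have -> : b k 0 = t * b k 0 + (1 - t) * b k 0 by lra.
apply: lerD; apply: ler_wpM2l; rewrite ?subr_ge0 //.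
  by have := Px k; rewrite mxE.
by have := Py k; rewrite mxE.
Qed.

End CubeCalculus.

Theorem theorem11 (R : realType) (n : nat)
  (F : 'rV[R]_n -> R) (sigma : R) (P : set 'rV[R]_n)
  (alpha mu beta OPT : R)
  (vstar : 'rV[R]_n) (vmax : 'rV[R]_n -> 'rV[R]_n)
  (F_C2 : C2_on_cube F)
  (F_mono : monotone_on_cube F)
  (F_ge0 : forall x, cube x -> 0 <= F x)
  (F_smooth : one_sided_smooth sigma F)
  (P_polytope : polytope_in_cube P)
  (P_down : downward_closed P)
  (alpha01 : 0 <= alpha < 1)
  (OPT_max : is_max P F OPT)
  (vstar_max : argmax P norm1 vstar)
  (vmax_max : forall x, P x -> argmax P (fun v => dotv v (grad F x)) (vmax x))
  (mu01 : 0 < mu <= 1)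
  (mu_bound : forall x, P x -> lev (alpha *: vstar) x ->
    mu * (OPT - F x) <= dotv (vmax x) (grad F x))
  (beta01 : 0 < beta <= 1)
  (beta_bound : forall (u x : 'rV[R]_n) (eps : R), P u -> P x ->
    0 <= eps <= 1 -> P (x + eps *: u) ->
    beta * dotv u (grad F x) <= dotv u (grad F (x + eps *: u))) :
  (1 - expR (- (beta * (1 - alpha) * mu))) * OPT
    <= F (alpha *: vstar + (1 - alpha) *: vmax (alpha *: vstar)).
Proof.
have [polyP PC] := P_polytope.
have [Pvs _] := vstar_max.
have [/andP[a0 a1] /andP[b0 b1] /andP[m0 m1]] := And3 alpha01 beta01 mu01.
have vs_ge0 i : 0 <= vstar 0 i by have /andP[] := PC _ Pvs i.
set x0 := alpha *: vstar; set v := vmax x0.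
have Px0 : P x0.
  by apply: (P_down vstar) => // i; rewrite !mxE ?mulr_ge0 // ler_piMl ?(ltW a1).
have [Pv _] := vmax_max _ Px0; rewrite -/v in Pv.
have v_ge0 i : 0 <= v 0 i by have /andP[] := PC _ Pv i.
(* The endpoint [t = 1 - alpha] is a convex combination of [vstar] and [v]; since [v >= 0], it
   dominates the earlier points, and [P] is downward closed. *)
have Pt t : 0 <= t <= 1 - alpha -> P (x0 + t *: v).
  move=> /andP[t0 t1]; apply: (P_down (x0 + (1 - alpha) *: v)) => [|i|i].
  - by apply: polyhedron_convex => //; rewrite a0 ltW.
  - by rewrite !mxE addr_ge0 // mulr_ge0.
  - by rewrite !mxE lerD2l ler_wpM2r.
have gap : (1 - alpha) * (beta * (mu * (OPT - F x0))) <=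
    F (x0 + (1 - alpha) *: v) - F x0.
  apply: line_increment_ge => [||t tI|t tI].
  - exact: (proj1 F_C2).
  - lra.
  - exact/PC/Pt.
  - apply: (@le_trans _ _ (beta * dotv v (grad F x0))).
      by rewrite ler_wpM2l ?(ltW b0) // mu_bound // => i.
    by apply: beta_bound => //; [lra|exact: Pt].
have Fx0 : 0 <= F x0 by exact/F_ge0/PC.
have OPT0 : 0 <= OPT by have [x [Px _] <-] := OPT_max; exact/F_ge0/PC.
set c := beta * (1 - alpha) * mu.
have cE : (1 - alpha) * (beta * (mu * (OPT - F x0))) = c * OPT - c * F x0.
  by rewrite /c; lra.
have c1 : c <= 1.
  apply: mulr_ile1 => //; rewrite ?mulr_ge0 ?mulr_ile1 //; lra.
(* Allows dropping [(1 - c) * F x0] from the lower bound [c * OPT + (1 - c) * F x0]. *)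
have cF : c * F x0 <= F x0 by rewrite ler_piMl.
have : (1 - expR (- c)) * OPT <= c * OPT.
  by rewrite ler_wpM2r //; have := expR_ge1Dx (- c); lra.
by lra.
Qed.
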